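(* For every positive integer $n>2$, Thompson's group $F = \langle x_0, x_1 \mid [x_0x_1^{-1}, x_0^{-1}x_1x_0],\ [x_0x_1^{-1}, x_0^{-2}x_1x_0^{2}] \rangle$ does not satisfy Cannon's almost convexity condition $AC(n)$ with respect to the generating set $\{x_0, x_1\}$.
   Context: Let $G$ be a group with finite generating set $X$, let $d_X$ be the word metric on $G$ (distance in the Cayley graph whose edges join $g$ and $gx^{\pm1}$, $x\in X$), and let $B(r)$ be the ball of radius $r$ about the identity. For a positive integer $k$, $G$ is almost convex $(k)$, or $AC(k)$, with respect to $X$ if there is a number $N(k)$ such that for all positive integers $r$ and all $y,z \in B(r)$ with $d_X(y,z)\le k$ there is a path in the Cayley graph from $y$ to $z$ of length at most $N(k)$ lying entirely in $B(r)$. Here $[a,b]$ denotes the commutator of $a$ and $b$. Equivalently, $F$ is the group with infinite presentation $\langle x_k,\ k\ge 0 \mid x_i^{-1}x_jx_i = x_{j+1} \text{ for } i<j\rangle$, with the same $x_0,x_1$. *)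

(* Defs.v *)
From HB Require Import structures.
From mathcomp Require Import all_boot generic_quotient boolp.

Set Implicit Arguments.
Unset Strict Implicit.
Unset Printing Implicit Defensive.

Local Open Scope group_scope.

(* (i, false) stands for the generator i and (i, true) for its inverse.
   Words are not reduced: they only form a baseGroupType, which is enough to
   write relators with the notations of group_scope. *)
Definition word (I : choiceType) : Type := seq (I * bool).

HB.instance Definition _ (I : choiceType) := Choice.on (word I).

Definition inv_letter (I : choiceType) (a : I * bool) : I * bool :=
  (a.1, ~~ a.2).

Definition word_inv (I : choiceType) (w : word I) : word I :=
  rev (map (@inv_letter I) w).

HB.instance Definition _ (I : choiceType) :=
  hasMul.Build (word I) (@cat (I * bool)).
HB.instance Definition _ (I : choiceType) := hasOne.Build (word I) [::].
HB.instance Definition _ (I : choiceType) :=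
  hasInv.Build (word I) (@word_inv I).

Definition letter (I : choiceType) (i : I) : word I := [:: (i, false)].

(* The congruence on words whose quotient is the group < I | R >. *)
Inductive pres_eq (I : choiceType) (R : seq (word I)) :
    word I -> word I -> Prop :=
  | pres_refl u : pres_eq R u u
  | pres_sym u v : pres_eq R u v -> pres_eq R v u
  | pres_trans v u w : pres_eq R u v -> pres_eq R v w -> pres_eq R u w
  | pres_cancel u v a : pres_eq R (u ++ [:: a; inv_letter a] ++ v) (u ++ v)
  | pres_rel u v r : r \in R -> pres_eq R (u ++ r ++ v) (u ++ v).

Section Presented.
Variables (I : choiceType) (R : seq (word I)).
Implicit Types u v w : word I.

Lemma inv_letterK : involutive (@inv_letter I).
Proof. by case=> i b; rewrite /inv_letter /= negbK. Qed.

Lemma pres_eq_catl w u v : pres_eq R u v -> pres_eq R (w ++ u) (w ++ v).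
Proof.
elim=> {u v} [u|u v _ /pres_sym //|v u t _ h1 _ h2|u v a|u v r Rr].
- exact: pres_refl.
- exact: pres_trans h1 h2.
- by rewrite !(catA w); apply: pres_cancel.
- by rewrite !(catA w); apply: pres_rel.
Qed.

Lemma pres_eq_catr w u v : pres_eq R u v -> pres_eq R (u ++ w) (v ++ w).
Proof.
elim=> {u v} [u|u v _ /pres_sym //|v u t _ h1 _ h2|u v a|u v r Rr].
- exact: pres_refl.
- exact: pres_trans h1 h2.
- by rewrite -!catA; apply: pres_cancel.
- by rewrite -!catA; apply: pres_rel.
Qed.

Lemma pres_eq_cat u u' v v' :
  pres_eq R u u' -> pres_eq R v v' -> pres_eq R (u ++ v) (u' ++ v').
Proof.
move=> /(pres_eq_catr v) h1 /(pres_eq_catl u') h2; exact: pres_trans h1 h2.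
Qed.

Lemma word_inv_cat u v : word_inv (u ++ v) = word_inv v ++ word_inv u.
Proof. by rewrite /word_inv map_cat rev_cat. Qed.

Lemma word_invK : involutive (@word_inv I).
Proof.
by move=> u; rewrite /word_inv map_rev revK mapK //; apply: inv_letterK.
Qed.

Lemma pres_eq_mulwV u : pres_eq R (u ++ word_inv u) [::].
Proof.
elim: u => [|a u IHu]; first exact: pres_refl.
rewrite -[a :: u]cat1s word_inv_cat -catA (catA u).
have h := pres_eq_catl [:: a] (pres_eq_catr (word_inv [:: a]) IHu).
exact: pres_trans h (@pres_cancel _ _ [::] [::] a).
Qed.

Lemma pres_eq_mulVw u : pres_eq R (word_inv u ++ u) [::].
Proof. by have := pres_eq_mulwV (word_inv u); rewrite word_invK. Qed.

Lemma pres_eq_inv u v : pres_eq R u v -> pres_eq R (word_inv u) (word_inv v).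
Proof.
move=> huv.
have h1 := pres_eq_catl (word_inv u) (pres_sym (pres_eq_mulwV v)).
have h2 := pres_eq_catl (word_inv u) (pres_eq_catr (word_inv v) huv).
have h3 := pres_eq_catr (word_inv v) (pres_eq_mulVw u).
rewrite cats0 in h1; rewrite -catA in h3.
exact: pres_trans h1 (pres_trans (pres_sym h2) h3).
Qed.

Definition pres_rel_bool u v : bool := `[< pres_eq R u v >].

Lemma pres_rel_bool_equiv : equiv_class_of pres_rel_bool.
Proof.
split=> [u|u v|v u w]; first by apply/asboolP/pres_refl.
  by apply/asboolP/asboolP; apply: pres_sym.
by move=> /asboolP h1 /asboolP h2; apply/asboolP/(pres_trans h1 h2).
Qed.

Canonical pres_equiv := EquivRelPack pres_rel_bool_equiv.

Local Open Scope quotient_scope.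

Definition presented : Type := {eq_quot pres_equiv}.

HB.instance Definition _ : EqQuotient _ pres_equiv presented :=
  EqQuotient.on presented.
HB.instance Definition _ := Choice.on presented.

Definition pres_class u : presented := \pi_presented u.

Lemma pres_classP u v : pres_class u = pres_class v <-> pres_eq R u v.
Proof.
split=> [/eqP|h]; first by rewrite /pres_class eqmodE => /asboolP.
by apply/eqP; rewrite /pres_class eqmodE; apply/asboolP.
Qed.

Lemma repr_pres_class u : pres_eq R (repr (pres_class u)) u.
Proof. by apply/pres_classP; rewrite /pres_class reprK. Qed.

Lemma pres_class_repr (g : presented) : pres_class (repr g) = g.
Proof. exact: reprK. Qed.

Definition pres_mul (g h : presented) : presented :=
  pres_class (repr g ++ repr h).
Definition pres_one : presented := pres_class [::].
Definition pres_inv (g : presented) : presented :=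
  pres_class (word_inv (repr g)).

Lemma pres_classM u v :
  pres_mul (pres_class u) (pres_class v) = pres_class (u ++ v).
Proof. by apply/pres_classP/pres_eq_cat; apply: repr_pres_class. Qed.

Lemma pres_classV u : pres_inv (pres_class u) = pres_class (word_inv u).
Proof. exact/pres_classP/pres_eq_inv/repr_pres_class. Qed.

Lemma pres_mulA : associative pres_mul.
Proof.
move=> x y z; rewrite -(pres_class_repr x) -(pres_class_repr y).
by rewrite -(pres_class_repr z) !pres_classM catA.
Qed.

Lemma pres_mul1 : left_id pres_one pres_mul.
Proof. by move=> x; rewrite -(pres_class_repr x) pres_classM. Qed.

Lemma pres_mulr1 : right_id pres_one pres_mul.
Proof. by move=> x; rewrite -(pres_class_repr x) pres_classM cats0. Qed.

Lemma pres_mulV : left_inverse pres_one pres_inv pres_mul.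
Proof.
move=> x; rewrite -(pres_class_repr x) pres_classV pres_classM.
exact/pres_classP/pres_eq_mulVw.
Qed.

Lemma pres_mulrV : right_inverse pres_one pres_inv pres_mul.
Proof.
move=> x; rewrite -(pres_class_repr x) pres_classV pres_classM.
exact/pres_classP/pres_eq_mulwV.
Qed.

HB.instance Definition _ := isGroup.Build presented
  pres_mulA pres_mul1 pres_mulr1 pres_mulV pres_mulrV.

Definition pres_gen (i : I) : presented := pres_class (letter i).

Lemma pres_class_mul u v : pres_class (u ++ v) = pres_class u * pres_class v.
Proof. by rewrite -pres_classM. Qed.

Lemma pres_class_inv u : pres_class (word_inv u) = (pres_class u)^-1.
Proof. by rewrite -pres_classV. Qed.

End Presented.

Definition generates (G : groupType) (X : seq G) : Prop :=
  forall S : {pred G}, group_closed S -> {subset X <= S} -> forall g, g \in S.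

Record genset (G : groupType) := Genset {
  gens :> seq G;
  gensP : generates gens
}.

Definition cayley_edge (G : groupType) (X : seq G) : rel G :=
  fun g h => has (fun x => (h == g * x) || (h == g * x^-1)) X.

(* p lists the vertices after g, so the length of the path is size p. *)
Definition cayley_path (G : groupType) (X : seq G) (g h : G) (p : seq G) :
    bool :=
  path (cayley_edge X) g p && (last g p == h).

Section WordMetric.
Variables (G : groupType) (X : genset G).
Implicit Types g h : G.

Lemma cayley_edgeP (Y : seq G) g h :
  reflect (exists2 x, x \in Y & h = g * x \/ h = g * x^-1) (cayley_edge Y g h).
Proof.
apply: (iffP hasP) => -[x Yx hx]; exists x => //.
  by case/orP: hx => /eqP ->; [left | right].
by apply/orP; case: hx => ->; [left | right].
Qed.

Lemma cayley_edge_sym (Y : seq G) g h : cayley_edge Y g h = cayley_edge Y h g.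
Proof.
by apply/cayley_edgeP/cayley_edgeP => -[x Yx [] ->]; exists x;
   rewrite ?mulgK ?mulgVK; auto.
Qed.

Lemma cayley_edge_mull (Y : seq G) a g h :
  cayley_edge Y (a * g) (a * h) = cayley_edge Y g h.
Proof.
apply: eq_has => x; rewrite -!mulgA.
by rewrite !(inj_eq (@mulgI _ a)).
Qed.

Lemma cayley_path_mull (Y : seq G) a g h p :
  cayley_path Y g h p -> cayley_path Y (a * g) (a * h) [seq a * x | x <- p].
Proof.
rewrite /cayley_path last_map => /andP[pp /eqP <-]; rewrite eqxx andbT.
by rewrite path_map; apply: sub_path pp => x y /=; rewrite cayley_edge_mull.
Qed.

Lemma cayley_connected g h :
  exists n, `[< exists2 p, cayley_path X g h p & size p = n >].
Proof.
suff [p] : exists p, cayley_path X g h p.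
  by exists (size p); apply/asboolP; exists p.
suff [p] : exists p, cayley_path X 1 (g^-1 * h) p.
  by move=> /(cayley_path_mull g); rewrite mulg1 mulVKg; eexists; eauto.
move: (g^-1 * h) => {g h} g.
pose S : {pred G} := fun g => `[< exists p, cayley_path X 1 g p >].
suff : g \in S by move=> /asboolP.
apply: (@gensP _ X S) => [|x Xx]; last first.
  apply/asboolP; exists [:: x]; rewrite /cayley_path /= eqxx !andbT.
  by apply/cayley_edgeP; exists x => //; left; rewrite mul1g.
split; first by apply/asboolP; exists [::]; rewrite /cayley_path /= eqxx.
move=> x y /asboolP[p hp] /asboolP[q hq]; apply/asboolP.
have /(cayley_path_mull (x / y)) : cayley_path X y 1 (rev (belast 1 q)).
  case/andP: hq => pq /eqP <-; apply/andP; split.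
    rewrite rev_path; apply: sub_path pq => a b.
    by rewrite cayley_edge_sym.
  by case: (q) => //= a s; rewrite rev_cons last_rcons.
rewrite mulgVK mulg1; set r := map _ _ => hr; exists (p ++ r).
case/andP: hp => pp /eqP lp; case/andP: hr => pr lr.
by rewrite /cayley_path cat_path last_cat lp pp pr.
Qed.

Definition cayley_dist g h : nat := ex_minn (cayley_connected g h).

Definition cayley_ball (r : nat) : {pred G} := [pred g | cayley_dist 1 g <= r].

Definition almost_convex (k : nat) : Prop :=
  exists N : nat, forall r : nat, 0 < r ->
    forall y z : G, y \in cayley_ball r -> z \in cayley_ball r ->
    cayley_dist y z <= k ->
    exists p : seq G, [/\ cayley_path X y z p, size p <= N
                        & {subset y :: p <= cayley_ball r}].

End WordMetric.

(* [~ a, b] is a^-1 b^-1 a b; with the convention a b a^-1 b^-1 the relators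
   have the same normal closure. *)
Definition thompson_relators : seq (word 'I_2) :=
  let x0 := letter ord0 in
  let x1 := letter ord_max in
  [:: [~ x0 * x1^-1, x0^-1 * x1 * x0];
      [~ x0 * x1^-1, x0 ^- 2 * x1 * x0 ^+ 2]].

Definition thompsonF : groupType := presented thompson_relators.

Definition tx0 : thompsonF := pres_gen thompson_relators ord0.
Definition tx1 : thompsonF := pres_gen thompson_relators ord_max.

Lemma thompson_generates : generates [:: tx0; tx1].
Proof.
move=> S clS XS g; have [S1 _] := clS.
have SM : mulg_closed S by apply: group_closedM.
have SV : invg_closed S by apply: group_closedV.
rewrite -[g](@pres_class_repr _ thompson_relators).
elim: (repr _) => [|[i b] w IHw]; first exact: S1.
rewrite -cat1s pres_class_mul; apply: SM => //.
have Si : pres_gen thompson_relators i \in S.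
  have [/eqP i0|/eqP i1] : i == ord0 \/ i == ord_max.
    by case: i => [[|[|]]] //= ?; [left | right].
  - by apply: XS; rewrite i0 inE eqxx.
  - by apply: XS; rewrite i1 !inE eqxx orbT.
case: b => //.
have -> : [:: (i, true)] = word_inv (letter i) by [].
by rewrite pres_class_inv; apply: SV.
Qed.

Definition thompson_genset : genset thompsonF := Genset thompson_generates.

(* Main.v *)
Require Import Defs.
From mathcomp Require Import all_boot all_order all_algebra boolp lra zify.

(** Thompson's group acts on the line from the right: [x0] is the translation
    by 1, and [x1] fixes the negative half-line, doubles [0, 1] and translates
    by 1 beyond 1.  Write f for the map of an element g.  A step of a path in
    the Cayley graph composes f on the left with the map of a letter, so it
    only distorts f where f takes values close to 0: an element is like a
    cursor that moves along f and edits it locally.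

    Fix n = m + 2 and compare the elements
      y = x0^n x1^-1 x0^-n x1^-2  and
      z = y x0^2 = x0^-1 x1^-2 x0^(n+1) x1^-1 x0^-(n-2).
    The two expressions of z agree because [x0 x1^-1] commutes with every
    conjugate x0^-j x1 x0^j with j > 0, which is the infinite presentation of F
    in disguise.  So y and z are at distance at most 2, and both lie in the
    ball of radius r = 2n + 3.  Their maps have an edit near -n, far to the
    left of the cursor, and another one just to the right of 0, where the slope
    drops from 1 to 1/4 at the point 1.

    On a path that leaves z, the map f sends 0 to 1 at first, and f moves as a
    block on the nonnegative half-line as long as f 0 stays at least 1.  At y
    the value of f at 0 is -1, so a path from z to y has a first step after
    which f 0 < 1.  At that step f still has its slope drop at 1, translates
    far away points by -2, and, if the path is short, still has its edit near
    -n (uncrossed_letter).  All such elements have length at least 2n + 4, by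
    the following count, so they are outside of the ball.

    The translation at large points is the exponent sum of a word w, whence
    size w = 2 p + 2 where p is the number of positive letters of w.  To edit f
    at -n, the point -n must first be brought up to 0, and this takes n letters
    [x0].  If w has no other positive letter, then the letters of w that act
    before 0 gets a negative image restrict to translations and to convex
    increasing maps, so f is convex at 0, 1, 2, which contradicts the slope
    drop; and once 0 has a negative image, another [x0] has to be spent on
    bringing it back.  Hence p > n (npos_gt). *)

Set Implicit Arguments.
Unset Strict Implicit.
Unset Printing Implicit Defensive.
Import Order.TTheory GRing.Theory Num.Theory.

Local Open Scope group_scope.

(** * Commutation in Thompson's group *)

Lemma commute_divgP (G : groupType) (x y u : G) :
  commute (x * y^-1) u <-> u ^ y = u ^ x.
Proof.
split=> [/commute_sym/commgP/conjg_fixP | uyx].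
  by rewrite conjgM => /(congr1 (conjg^~ y)); rewrite conjgKV.
by apply/commute_sym/commgP/conjg_fixP; rewrite conjgM -uyx conjgK.
Qed.

(** With c_j the conjugate of y by x^j, commutation of x y^-1 and c_j says that
    y and x conjugate c_j to the same element c_(j+1).  The conjugates of this
    fact by powers of x say that c_1 and x conjugate c_j to the same element
    for j > 1, and that is what makes the induction go. *)
Lemma commute_conj_expg (G : groupType) (x y : G) :
  commute (x * y^-1) (y ^ x) -> commute (x * y^-1) (y ^ (x ^+ 2)) ->
  forall j, commute (x * y^-1) (y ^ (x ^+ j.+1)).
Proof.
move=> /commute_divgP h1 /commute_divgP h2 j; apply/commute_divgP.
have sh i : y ^ (x ^+ i.+1) = (y ^ (x ^+ i)) ^ x by rewrite expgSr conjgM.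
have [k] := ubnP j; elim: k j => // k IHk [|[|j]] lt_jk.
- by rewrite expg1.
- exact: h2.
have h3 := IHk j (ltnW lt_jk); have h4 := IHk j.+1 lt_jk.
have -> : y ^ (x ^+ j.+3) = (y ^ (x ^+ j.+2)) ^ (y ^ x).
  by rewrite (sh j.+2) (sh j.+1) -conjJg h3.
by rewrite [LHS]conjJg h4 h1 -conjJg.
Qed.

(** With t = x y^-1 and c the conjugate of y by x^(m+2), the two sides are
    x^(m+1) t c^-2 x^-m and x^(m+1) c^-2 t x^-m. *)
Lemma twin_words_eq (G : groupType) (x y : G) m :
    commute (x * y^-1) (y ^ (x ^+ m.+2)) ->
  x ^+ m.+2 * y^-1 * x ^- m.+2 * (y^-1 * y^-1) * (x * x) =
  x^-1 * (y^-1 * y^-1) * x ^+ m.+3 * y^-1 * x ^- m.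
Proof.
have -> : y^-1 * y^-1 = y ^- 2 by rewrite -expVgn expgS expg1.
move=> /(@commuteX _ _ _ 2)/commuteV; rewrite -conjXg -conjVg conjgE.
have px : commute (x ^+ m.+1) x by apply/commute_sym/commuteX.
have -> : x ^- m = x * x ^- m.+1 by rewrite expgSr invgM mulVKg.
rewrite (expgSr x m.+2) (expgSr x m.+1).
move: (x ^+ m.+1) px (y ^- 2) (y^-1) => p px v u xy.
have e : x^-1 * p^-1 * (x * x) = x * p^-1.
  by rewrite -invgM px invgM -!mulgA mulKg (commuteV (commute_sym px)).
transitivity (p * (x * u * ((p * x)^-1 * (v * (p * x)))) * (x * p^-1)).
  by rewrite -e !invgM !mulgA !mulgK.
by rewrite xy {1}px invgM !mulgA mulgV mul1g.
Qed.

Definition letter_class (I : choiceType) (R : seq (word I)) (a : I * bool) :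
  presented R := pres_class R [:: a].

Lemma pres_class_cons (I : choiceType) (R : seq (word I)) a w :
  pres_class R (a :: w) = letter_class R a * pres_class R w.
Proof. by rewrite -cat1s pres_class_mul. Qed.

Lemma pres_class_nil (I : choiceType) (R : seq (word I)) :
  pres_class R [::] = 1.
Proof. by []. Qed.

Lemma letter_classE (I : choiceType) (R : seq (word I)) a :
  letter_class R a = if a.2 then (pres_gen R a.1)^-1 else pres_gen R a.1.
Proof. by case: a => i [] //=; rewrite -pres_class_inv. Qed.

Lemma pres_class_nseq (I : choiceType) (R : seq (word I)) k a w :
  pres_class R (nseq k a ++ w) = letter_class R a ^+ k * pres_class R w.
Proof.
elim: k => [|k IHk] /=; first by rewrite expg0 mul1g.
by rewrite pres_class_cons IHk mulgA -expgS.
Qed.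

Local Notation F := thompsonF.
Local Notation X := thompson_genset.
Local Notation class := (pres_class thompson_relators).
Local Notation lclass := (@letter_class _ thompson_relators).

Lemma class_mul (u v : word 'I_2) : class (u * v) = class u * class v.
Proof. exact: pres_class_mul. Qed.

Lemma class_inv (u : word 'I_2) : class u^-1 = (class u)^-1.
Proof. exact: pres_class_inv. Qed.

Lemma thompson_commutations :
  commute (tx0 * tx1^-1) (tx1 ^ tx0) /\
  commute (tx0 * tx1^-1) (tx1 ^ (tx0 ^+ 2)).
Proof.
have rel r : r \in thompson_relators -> class r = 1.
  move=> Rr; apply/pres_classP.
  by have := pres_rel [::] [::] Rr; rewrite !cats0.
split; apply/commgP/eqP.
  have := rel _ (mem_head _ _).
  by rewrite /commg /conjg !(class_mul, class_inv) -!mulgA.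
have := rel _ (mem_last _ _); rewrite /= /commg /conjg.
have e2 : class (letter ord0 ^+ 2) = tx0 ^+ 2 := class_mul _ _.
by rewrite !(e2, class_mul, class_inv) -!mulgA.
Qed.

Definition right_word (m : nat) : word 'I_2 :=
  nseq m.+2 (ord0, false) ++ (ord_max, true) ::
  nseq m.+2 (ord0, true) ++ [:: (ord_max, true); (ord_max, true)].

(** A word of the same length as [right_word m] for an element that is two
    edges away: multiplying by [x0] twice does not lengthen the word, because
    the edit on the right can be made first instead of last. *)
Definition left_word (m : nat) : word 'I_2 :=
  [:: (ord0, true), (ord_max, true), (ord_max, true) &
   nseq m.+3 (ord0, false) ++ (ord_max, true) :: nseq m (ord0, true) ++ [::]].

Lemma left_word_class m :
  class (left_word m) =
  class (right_word m) * class [:: (ord0, false); (ord0, false)].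
Proof.
have [c1 c2] := thompson_commutations.
have := twin_words_eq (commute_conj_expg c1 c2 m.+1).
rewrite /left_word 3!pres_class_cons pres_class_nseq pres_class_cons.
rewrite pres_class_nseq /right_word pres_class_nseq pres_class_cons.
rewrite pres_class_nseq !pres_class_cons !letter_classE /= -/tx0 -/tx1 !expVgn.
(* The powers are generalized so that [mulgA] does not unfold them. *)
move: (tx0 ^+ m.+2) (tx0 ^+ m.+3) (tx0 ^+ m) => p q s tw.
by rewrite pres_class_nil !mulg1 -!mulgA in tw *; rewrite tw.
Qed.

Lemma size_right_word m : size (right_word m) = 2 * m + 7.
Proof. by rewrite /right_word !size_cat /= !size_cat !size_nseq /=; lia. Qed.

Lemma size_left_word m : size (left_word m) = 2 * m + 7.
Proof. by rewrite /left_word /= !size_cat /= !size_cat !size_nseq /=; lia. Qed.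

(** * Words and paths in the Cayley graph *)

Lemma thompson_edgeP (g h : F) :
  reflect (exists a, h = g * lclass a) (cayley_edge X g h).
Proof.
apply: (iffP (cayley_edgeP _ _ _)) => [[x] | [[i b] ->]].
  rewrite !inE => /orP[] /eqP -> [] ->.
  - by exists (ord0, false); rewrite letter_classE.
  - by exists (ord0, true); rewrite letter_classE.
  - by exists (ord_max, false); rewrite letter_classE.
  - by exists (ord_max, true); rewrite letter_classE.
exists (pres_gen thompson_relators i); last first.
  by rewrite letter_classE /=; case: b; [right | left].
case: i => [[|[|//]] lti]; rewrite !inE; apply/orP; [left | right]; apply/eqP.
  by rewrite /tx0; congr pres_gen; apply: val_inj.
by rewrite /tx1; congr pres_gen; apply: val_inj.
Qed.

Lemma word_path (g : F) w :
  exists2 p, cayley_path X g (g * class w) p & size p = size w.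
Proof.
elim: w g => [|a w IHw] g.
  by exists [::] => //; rewrite /cayley_path /= pres_class_nil mulg1.
have [p pP sp] := IHw (g * lclass a).
exists (g * lclass a :: p); last by rewrite /= sp.
rewrite /cayley_path /= pres_class_cons mulgA; case/andP: pP => -> ->.
by rewrite !andbT; apply/thompson_edgeP; exists a.
Qed.

Lemma path_word (g h : F) p :
  cayley_path X g h p -> exists2 w, h = g * class w & size w = size p.
Proof.
rewrite /cayley_path; elim: p g => [|g' p IHp] g /=.
  by move=> /eqP <-; exists [::] => //; rewrite pres_class_nil mulg1.
case/andP=> /andP[/thompson_edgeP[a ->] pp] lp.
have [|w -> <-] := IHp (g * lclass a); first by rewrite pp lp.
by exists (a :: w) => //; rewrite pres_class_cons mulgA.
Qed.

Lemma cayley_dist_word (g : F) w : cayley_dist X g (g * class w) <= size w.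
Proof.
rewrite /cayley_dist; case: ex_minnP => k _; apply; apply/asboolP.
exact: word_path.
Qed.

Lemma cayley_ballP r (g : F) :
  reflect (exists2 w, g = class w & size w <= r) (g \in cayley_ball X r).
Proof.
apply: (iffP idP) => [|[w -> le_wr]]; rewrite inE; last first.
  by have := cayley_dist_word 1 w; rewrite mul1g => /leq_trans; apply.
rewrite /cayley_dist; case: ex_minnP => k /asboolP[p pP <-] _ le_pr.
by have [w -> wE] := path_word pP; exists w; rewrite ?mul1g ?wE.
Qed.

Local Open Scope ring_scope.

(** * The action on the line *)

Definition squeeze (x : rat) : rat :=
  if x <= 0 then x else if x <= 2 then x / 2 else x - 1.

Definition stretch (x : rat) : rat :=
  if x <= 0 then x else if x <= 1 then 2 * x else x + 1.

Definition letter_act (a : 'I_2 * bool) (x : rat) : rat :=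
  match a.1 == ord0, a.2 with
  | true, false => x + 1
  | true, true => x - 1
  | false, false => stretch x
  | false, true => squeeze x
  end.

Definition word_act (w : word 'I_2) (x : rat) : rat :=
  foldl (fun y a => letter_act a y) x w.

Lemma squeezeK : cancel squeeze stretch.
Proof.
rewrite /squeeze /stretch => x.
by case: (lerP x 0) => ?; [|case: (lerP x 2) => ?]; do 2?[case: ifP => ?]; lra.
Qed.

Lemma stretchK : cancel stretch squeeze.
Proof.
rewrite /squeeze /stretch => x.
by case: (lerP x 0) => ?; [|case: (lerP x 1) => ?]; do 2?[case: ifP => ?]; lra.
Qed.

Lemma squeeze_le0 x : x <= 0 -> squeeze x = x.
Proof. by rewrite /squeeze => ->. Qed.

Lemma squeeze_ge2 x : 2 <= x -> squeeze x = x - 1.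
Proof. by rewrite /squeeze => ?; do 2?[case: ifP => ?]; lra. Qed.

Lemma stretch_ge1 x : 1 <= x -> stretch x = x + 1.
Proof. by rewrite /stretch => ?; do 2?[case: ifP => ?]; lra. Qed.

Lemma letter_act_le0 a x : a.1 != ord0 -> x <= 0 -> letter_act a x = x.
Proof.
case: a => i [] /= /negbTE i0 x0;
by rewrite /letter_act /= i0 /squeeze /stretch x0.
Qed.

Lemma letter_actK a : cancel (letter_act a) (letter_act (inv_letter a)).
Proof.
rewrite /letter_act /inv_letter => x; case: a => i [] /=; case: (i == ord0).
- by rewrite subrK.
- exact: squeezeK.
- by rewrite addrK.
- exact: stretchK.
Qed.

Lemma word_act_cat u v x : word_act (u ++ v) x = word_act v (word_act u x).
Proof. exact: foldl_cat. Qed.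

Lemma word_act_rcons w a : word_act (rcons w a) = letter_act a \o word_act w.
Proof. by apply/funext => x; rewrite -cats1 word_act_cat. Qed.

Lemma word_actK u : cancel (word_act u) (word_act (word_inv u)).
Proof.
elim: u => //= a u IHu x.
rewrite -[a :: u]cat1s word_inv_cat !word_act_cat /=.
by rewrite IHu letter_actK.
Qed.

Lemma word_act_commg u v :
  (forall x, word_act v (word_act u x) = word_act u (word_act v x)) ->
  forall x, word_act [~ u, v]%g x = x.
Proof.
move=> uv x.
have -> : [~ u, v]%g = word_inv u ++ word_inv v ++ u ++ v by [].
have K w y : word_act w (word_act (word_inv w) y) = y.
  by rewrite -{1}[w]word_invK word_actK.
by rewrite !word_act_cat uv !K.
Qed.

Lemma commute_disjoint_supports (c : rat) (f g : rat -> rat) :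
    (forall x, x <= c -> f x <= c) -> (forall x, c <= x -> f x = x) ->
    (forall x, c <= x -> c <= g x) -> (forall x, x <= c -> g x = x) ->
  forall x, g (f x) = f (g x).
Proof.
move=> f_le f_id g_ge g_id x; have [le_xc | /ltW le_cx] := lerP x c.
  by rewrite (g_id x) // g_id ?f_le.
by rewrite (f_id x) // f_id ?g_ge.
Qed.

(** The map of x0 x1^-1 is supported below 1, and the maps of the conjugates
    of x1 by x0 and by its square are supported above 1. *)
Lemma word_act_relators r x : r \in thompson_relators -> word_act r x = x.
Proof.
pose x0 : word 'I_2 := letter ord0; pose x1 : word 'I_2 := letter ord_max.
have act_u y : word_act (x0 * x1^-1)%g y = squeeze (y + 1) by [].
have act_v y : word_act (x0^-1 * x1 * x0)%g y = stretch (y - 1) + 1 by [].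
have act_v' y :
  word_act (x0^-2 * x1 * x0 ^+ 2)%g y = stretch (y - 1 - 1) + 1 + 1 by [].
rewrite !inE -/x0 -/x1 => /orP[] /eqP ->; apply: word_act_commg;
  apply: (@commute_disjoint_supports 1) => {}x;
  rewrite ?act_u ?act_v ?act_v' /squeeze /stretch => ?;
  do 2?[case: ifP => ?]; lra.
Qed.

Lemma pres_eq_act u v :
  pres_eq thompson_relators u v -> word_act u =1 word_act v.
Proof.
elim=> {u v} [u|u v _ IH|v u w _ IH1 _ IH2|u v a|u v r Rr] x //.
- by rewrite IH1 IH2.
- by rewrite !word_act_cat /= letter_actK.
- by rewrite !word_act_cat (word_act_relators _ Rr).
Qed.

Definition act (g : F) : rat -> rat := word_act (repr g).

Lemma act_class w : act (class w) = word_act w.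
Proof. by apply/funext; exact/pres_eq_act/repr_pres_class. Qed.

Lemma act_letter g a : act (g * lclass a)%g = letter_act a \o act g.
Proof.
rewrite -[g](@pres_class_repr _ thompson_relators) -pres_class_mul.
by rewrite !act_class cats1 word_act_rcons.
Qed.

(** * Counting positive letters *)

Definition npos (w : word 'I_2) := count (fun a => ~~ a.2) w.
Definition nneg (w : word 'I_2) := count (fun a => a.2) w.

Lemma npos_rcons w a : npos (rcons w a) = (npos w + ~~ a.2)%N.
Proof. by rewrite /npos -cats1 count_cat /= addn0. Qed.

Lemma size_npos_nneg w : size w = (npos w + nneg w)%N.
Proof. by rewrite addnC -(count_predC (fun a => a.2) w). Qed.

(** A letter moves a point by at most 1, so a point that starts far enough to
    the right stays in the domain where all letters are translations. *)
Lemma word_act_far (w : word 'I_2) (x : rat) : (size w).+1%:R < x ->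
  word_act w x = x + (npos w)%:R - (nneg w)%:R.
Proof.
elim: w x => [|[i b] w IHw] x /=; first by rewrite /npos /nneg /= addr0 subr0.
rewrite -!natr1 => lt_wx; have w0 := ler0n rat (size w).
have -> : letter_act (i, b) x = if b then x - 1 else x + 1.
  rewrite /letter_act /= /squeeze /stretch.
  by case: (i == ord0) b => [] [] //; do 2?[case: ifP => ?]; lra.
by case: b => /=; rewrite IHw -?natr1; rewrite /npos /nneg /= ?natrD; lra.
Qed.

(** The part of the line below -d has only been translated, and has not been
    brought above 0: the least such d is a lower bound for the number of
    positive letters. *)
Definition rigid_below (f : rat -> rat) (d : nat) : Prop :=
  f (- d%:R) <= 0 /\ forall x, x <= - d%:R -> f x = f (- d%:R) + x + d%:R.

Lemma rigid_belowS f d : rigid_below f d -> rigid_below f d.+1.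
Proof.
move=> [f0 fT]; rewrite /rigid_below -natr1.
split=> [|x le_xd]; first by rewrite fT; lra.
by rewrite (fT x) ?(fT (- (d%:R + 1))); lra.
Qed.

Lemma rigid_below_leq f d e : (d <= e)%N -> rigid_below f d -> rigid_below f e.
Proof.
by move=> /subnKC <-; elim: (e - d)%N => [|k IHk]; rewrite ?addn0 // addnS =>
  /IHk/rigid_belowS.
Qed.

Lemma rigid_below_letter a f d : rigid_below f d ->
  rigid_below (letter_act a \o f) (d + ~~ a.2).
Proof.
move=> [f0 fT]; have [a0 | a1] := eqVneq a.1 ord0; last first.
  apply: (@rigid_below_leq _ d); first exact: leq_addr.
  split=> [|x le_xd]; rewrite /= !letter_act_le0 // fT //; lra.
case: a a0 => i b /= ->; rewrite /rigid_below /letter_act /=.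
case: b => /=; rewrite ?addn0 ?addn1 -?natr1.
  by split=> [|x /fT ->]; lra.
split=> [|x le_xd]; first by rewrite fT; lra.
by rewrite (fT x) ?(fT (- (d%:R + 1))); lra.
Qed.

(** What d positive letters can achieve.  Either one of them was spent without
    any gain on the left, or all of them served to move the left part up.  In
    the second case, as long as 0 has a nonnegative image, f is convex on the
    nonnegative half-line, of which only the points 0, 1, 2 are recorded; and
    if 0 has a negative image, then so does -d, with a margin of 1, so that the
    next positive letter will be spent without gain. *)
Definition frugal (f : rat -> rat) (d : nat) : Prop :=
  (exists2 e, rigid_below f e & (e < d)%N) \/
  rigid_below f d /\
  ([/\ 0 <= f 0, f 0 <= f 2 & 2 * f 1 <= f 0 + f 2] \/
   (f 0 < 0 /\ f (- d%:R) <= - 1)).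

Lemma frugal_letter a f d : frugal f d ->
  frugal (letter_act a \o f) (d + ~~ a.2).
Proof.
case=> [[e fe lt_ed]|[fd fE]].
  left; exists (e + ~~ a.2)%N; last by rewrite ltn_add2r.
  exact: rigid_below_letter.
case: a => i b; have [-> | i1] := eqVneq i ord0; last first.
  case: b => /=; last first.
    (* A letter [x1] fixes the negative half-line: no gain on the left. *)
    left; exists d; last by rewrite addn1.
    case: fd => f0 fT.
    by split=> [|x le_xd]; rewrite /= !letter_act_le0 // fT //; lra.
  (* [squeeze] is convex and increasing on the nonnegative half-line. *)
  right; split; first exact: (@rigid_below_letter (i, true)).
  rewrite addn0 /letter_act /= (negbTE i1) /squeeze.
  case: fE => [[f0 f02 f12]|[f0 fd1]]; [left | right].
    by split; do 6?[case: ifP => ?]; lra.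
  by rewrite !ifT; lra.
case: b; rewrite /= ?addn0 ?addn1.
  right; split.
    by have := rigid_below_letter (ord0, true) fd; rewrite addn0.
  rewrite /letter_act /=; case: fd fE => f0 fT [[f00 f02 f12]|[f00 fd1]].
    by have [f1|f1] := lerP 1 (f 0); [left; split | right]; lra.
  by right; lra.
case: fE => [[f00 f02 f12]|[f00 fd1]].
  right; split.
    by have := rigid_below_letter (ord0, false) fd; rewrite addn1.
  by left; rewrite /letter_act /=; split; lra.
(* Here -d is at most -1, so it is still nonpositive after this [x0]. *)
left; exists d => //; case: fd => f0 fT.
by rewrite /rigid_below /letter_act /=; split=> [|x /fT ->]; lra.
Qed.

Lemma word_act_frugal w : frugal (word_act w) (npos w).
Proof.
elim/last_ind: w => [|w a IHw].
  right; split; last by left; rewrite /=; split; lra.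
  by split=> [|x]; rewrite /npos /= ?oppr0 //; lra.
by rewrite npos_rcons word_act_rcons; apply: frugal_letter.
Qed.

(** An edit to the left of -n costs n + 1 positive letters, and a concave
    corner at 1 one more. *)
Lemma npos_gt (w : word 'I_2) n :
    ~ rigid_below (word_act w) n -> 0 <= word_act w 0 ->
    word_act w 0 + word_act w 2 < 2 * word_act w 1 -> (n.+1 < npos w)%N.
Proof.
move=> w_n w0 w12; rewrite ltnNge; apply/negP => le_wn; apply: w_n.
case: (word_act_frugal w) => [[e we lt_ew] | [_ [[_ _ ?]|[? _]]]]; last 2 first.
- by exfalso; lra.
- by exfalso; lra.
by apply: rigid_below_leq we; rewrite -ltnS; apply: leq_trans le_wn.
Qed.

(** The point r + 2 is far enough for words of length at most r, so its image
    determines the exponent sum -k of all these words. *)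
Lemma ball_lower_bound (g : F) (n k r : nat) :
    g \in cayley_ball X r -> ~ rigid_below (act g) n -> 0 <= act g 0 ->
    act g 0 + act g 2 < 2 * act g 1 ->
    act g r.+2%:R = r.+2%:R - k%:R -> (2 * n.+2 + k <= r)%N.
Proof.
case/cayley_ballP=> w -> le_wr; rewrite act_class => w_n w0 w12.
rewrite word_act_far ?ltr_nat ?ltnS // => far.
have lt_nw := npos_gt w_n w0 w12.
have e : (npos w + k)%N = nneg w.
  by apply/eqP; rewrite -(eqr_nat rat) natrD; apply/eqP; lra.
by move: le_wr; rewrite size_npos_nneg -e; lia.
Qed.

(** * Short paths cannot cross *)

Definition bent (m : nat) (f : rat -> rat) : Prop :=
  f (- m%:R) = f (- m.+1%:R) + 2^-1.

Lemma bent_not_rigid m f : bent m f -> ~ rigid_below f m.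
Proof.
by rewrite /bent -natr1 => fm [_ /(_ (- (m%:R + 1)))]; lra.
Qed.

(** The elements on the side of z: on the nonnegative half-line, sampled at 0,
    1, 2 and at a far point L, f is the map of z up to an integer translation,
    and 0 has a positive image.  The bound b tells how far the bend on the left
    is from 0, where it could be edited. *)
Definition uncrossed (m : nat) (L b : rat) (f : rat -> rat) : Prop :=
  [/\ exists c : nat, f 0 = c%:R + 1, f 1 = f 0 + 1, f 2 = f 0 + 5 / 4
    & f L = f 0 + L - 2] /\ bent m f /\ f (- m%:R) <= b.

Definition crossed (m : nat) (L : rat) (f : rat -> rat) : Prop :=
  [/\ 0 <= f 0, f 0 + f 2 < 2 * f 1, f L = L - 2 & bent m f].

(** If f 0 >= 2, every letter translates the nonnegative half-line, and so does
    every positive letter if f 0 = 1.  The two other letters give a crossed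
    map: x0^-1 makes f 0 vanish, and x1^-1 maps 1, 2, 9/4 to 1/2, 1, 5/4, where
    the concave corner is weaker but still there. *)
Lemma uncrossed_letter m L b f a : 3 <= L -> b <= 0 -> uncrossed m L b f ->
  uncrossed m L (b + 1) (letter_act a \o f) \/ crossed m L (letter_act a \o f).
Proof.
rewrite /uncrossed /crossed /bent => L3 b0 [[[c f0] f1 f2 fL] [fm fb]].
have c0 := ler0n rat c.
case: a => i e; have [-> | i1] := eqVneq i ord0.
  rewrite /letter_act /=; case: e => /=.
    case: c c0 f0 => [|c] c0 f0; [right; split; lra | left].
    move: c0 f0; rewrite -natr1 => c0 f0.
    by split; split; try lra; exists c; lra.
  by left; split; split; try lra; exists c.+1; rewrite -natr1; lra.
have id0 y : y <= 0 -> letter_act (i, e) y = y by apply: letter_act_le0.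
rewrite /= !(id0 (f (- _))); try lra.
rewrite /letter_act /= (negbTE i1); case: e {id0} => /=; last first.
  left; rewrite !stretch_ge1; try lra.
  by split; split; try lra; exists c.+1; rewrite -natr1; lra.
case: c c0 f0 => [|c] c0 f0.
  by right; rewrite /squeeze; split; do 6?[case: ifP => ?]; lra.
have c1 := ler0n rat c; move: f0; rewrite -natr1 => f0; left.
rewrite !squeeze_ge2; try lra.
by split; split; try lra; exists c; lra.
Qed.

Lemma crossed_notin_ball m r (g : F) : (r < 2 * m.+3)%N ->
  crossed m r.+2%:R (act g) -> g \notin cayley_ball X r.
Proof.
move=> lt_rm [g0 g12 gL gm]; apply/negP => gr.
have := @ball_lower_bound g m 2 r gr (bent_not_rigid gm) g0 g12 gL.
by move: lt_rm; lia.
Qed.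

Lemma uncrossed_path m r (b : rat) (g : F) p : (0 < r < 2 * m.+3)%N ->
    b + (size p)%:R <= 1 ->
    path (cayley_edge X) g p -> {subset p <= cayley_ball X r} ->
    uncrossed m r.+2%:R b (act g) ->
  uncrossed m r.+2%:R (b + (size p)%:R) (act (last g p)).
Proof.
case/andP=> r0 lt_rm; elim: p g b => [|h p IHp] g b /=; first by rewrite addr0.
rewrite -natr1 => bp /andP[/thompson_edgeP[a hE] pp] pr gU.
have s0 := ler0n rat (size p).
have L3 : (3%:R : rat) <= r.+2%:R by rewrite ler_nat ltnS.
have hA : act h = letter_act a \o act g by rewrite hE act_letter.
have [|hU|hC] := @uncrossed_letter m _ b (act g) a L3 _ gU; first by lra.
  rewrite [b + _](_ : _ = b + 1 + (size p)%:R); last by lra.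
  apply: IHp => //; first by lra.
    by move=> x px; apply: pr; rewrite inE px orbT.
  by rewrite hA.
have /negP[] := @crossed_notin_ball m r h lt_rm (eq_ind_r _ hC hA).
by apply: pr; rewrite inE eqxx.
Qed.

(** * The two elements on either side *)

Lemma word_act_nseq k b w x :
  word_act (nseq k (ord0, b) ++ w) x =
  word_act w (if b then x - k%:R else x + k%:R).
Proof.
elim: k x => [|k IHk] x /=; first by case: b; rewrite ?subr0 ?addr0.
by rewrite IHk -natr1 /letter_act /=; congr word_act; case: (b); lra.
Qed.

Lemma word_act_right m x : word_act (right_word m) x =
  squeeze (squeeze (squeeze (x + m.+2%:R) - m.+2%:R)).
Proof.
by rewrite /right_word word_act_nseq -cat1s word_act_cat word_act_nseq.
Qed.

Lemma act_right0 m : act (class (right_word m)) 0 = - 1.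
Proof.
have m0 := ler0n rat m.
rewrite act_class word_act_right -!natr1 (@squeeze_ge2 (0 + _)); last by lra.
by rewrite add0r [_ - 1 - _]addrAC subrr sub0r.
Qed.

Lemma uncrossed_left m L : 4 <= L ->
  uncrossed m.+1 L (2^-1 - m%:R) (act (class (left_word m))).
Proof.
move=> L4; have m0 := ler0n rat m.
have m1 : m.+1%:R = m%:R + 1 :> rat by rewrite natr1.
have m2 : m.+2%:R = m%:R + 1 + 1 :> rat by rewrite !natr1.
have E x : act (class (left_word m)) x =
    squeeze (squeeze (squeeze (x + m.+2%:R) - m.+2%:R)) + 2.
  rewrite left_word_class -pres_class_mul act_class word_act_cat word_act_right.
  by rewrite /= /letter_act /=; lra.
have Ege x : 0 <= x ->
    act (class (left_word m)) x = squeeze (squeeze (x - 1)) + 2.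
  move=> xge; rewrite E (@squeeze_ge2 (x + m.+2%:R)); last by rewrite m2; lra.
  by congr (squeeze (squeeze _) + 2); lra.
have Ele x : - m.+2%:R <= x -> x <= - m.+1%:R ->
    act (class (left_word m)) x = (x + m.+2%:R) / 2 - m%:R.
  rewrite E m1 m2 => ? ?.
  have -> : squeeze (x + (m%:R + 1 + 1)) = (x + (m%:R + 1 + 1)) / 2.
    by rewrite /squeeze; do 2?[case: ifP => ?]; lra.
  by rewrite !(@squeeze_le0 (_ / 2 - _)); lra.
split; last by rewrite /bent !Ele ?m1 ?m2; try split; lra.
rewrite !Ege; try lra.
have -> : squeeze (squeeze (0 - 1)) = - 1 by [].
have -> : squeeze (squeeze (1 - 1)) = 0 by [].
have -> : squeeze (squeeze (2 - 1)) = 1 / 4 by [].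
split; try lra; first by exists 0%N; lra.
by rewrite (@squeeze_ge2 (L - 1)) ?squeeze_ge2; lra.
Qed.

Lemma thompson_not_almost_convex k :
  (1 < k)%N -> ~ almost_convex thompson_genset k.
Proof.
(* With m = N + 1 the map of z sends the bend to 1/2 - m < - N, so its image
   stays below 0 during the first N steps. *)
move=> k2 [N /(_ (2 * N.+1 + 7)%N) ac].
have [||||p [/andP[pp /eqP lp] le_pN p_ball]] :=
  ac _ (class (left_word N.+1)) (class (right_word N.+1)).
- by lia.
- by apply/cayley_ballP; exists (left_word N.+1); rewrite ?size_left_word.
- by apply/cayley_ballP; exists (right_word N.+1); rewrite ?size_right_word.
- have -> : class (right_word N.+1) = (class (left_word N.+1) *
      class (word_inv [:: (ord0, false); (ord0, false)]))%g.
    by rewrite left_word_class pres_class_inv mulgK.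
  by apply: leq_trans k2; exact: cayley_dist_word.
have r_bounds : (0 < 2 * N.+1 + 7 < 2 * N.+2.+3)%N by lia.
have pN : (size p)%:R <= N%:R :> rat by rewrite ler_nat.
have L4 : 4%:R <= (2 * N.+1 + 7).+2%:R :> rat by rewrite ler_nat; lia.
have := uncrossed_path r_bounds _ pp _ (uncrossed_left N.+1 L4).
rewrite lp => -[||[[c]]].
- by rewrite -[N.+1%:R]natr1; lra.
- by move=> g gp; apply: p_ball; rewrite inE gp orbT.
by rewrite act_right0; have := ler0n rat c; lra.
Qed.

Local Close Scope ring_scope.
Local Close Scope group_scope.

Theorem corollary1p2 (n : nat) (hn : 2 < n) :
  ~ almost_convex thompson_genset n.
Proof. exact: thompson_not_almost_convex (ltnW hn). Qed.
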